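(* Let $n\ge 1$. For a real $n\times n$ matrix $M$ let $\sigma(M)\in Gr(n,2n)$ be the row span of the $n\times 2n$ matrix $(I\mid M')$, where $I$ is the identity matrix and $M'_{ij}=(-1)^{n-i}M_{(n+1-i)\,j}$. (1) $\sigma(M)\in LG^R(n,2n)$ if and only if $M$ is symmetric with respect to the antidiagonal. (2) $\sigma(M)\in Gr_{\ge0}(n,2n)$ if and only if $M$ is totally nonnegative. In other words, the restriction of $\sigma$ to the set of real $n\times n$ matrices that are totally nonnegative and symmetric with respect to the antidiagonal is an embedding into $LG^R_{\ge0}(n,2n)$ with dense image.
   Context: $Gr(n,2n)$ is the real Grassmannian of $n$-dimensional subspaces of $\mathbb R^{2n}$; $Gr_{\ge0}(n,2n)$ is the set of those $X$ that have a representing $n\times 2n$ matrix (rows a basis of $X$) with all maximal minors nonnegative. $R(x,y)=\sum_{i=1}^n(-1)^{i-1}(x_iy_{n+i}-x_{n+i}y_i)$; $LG^R(n,2n)=\{X\in Gr(n,2n):R(x,y)=0\ \forall x,y\in X\}$; $LG^R_{\ge0}(n,2n)=LG^R(n,2n)\cap Gr_{\ge0}(n,2n)$ (subspace topology). A matrix is totally nonnegative if all its minors (of all sizes) are nonnegative. $M$ is symmetric with respect to the antidiagonal if $M_{ij}=M_{(n+1-j)(n+1-i)}$ for all $i,j$. *)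

(* Defs.v *)
From HB Require Import structures.
From mathcomp Require Import all_boot all_order all_algebra.
From mathcomp Require Import generic_quotient.
From mathcomp Require Import all_classical all_reals all_analysis.

Set Implicit Arguments.
Unset Strict Implicit.
Unset Printing Implicit Defensive.

Import Order.TTheory GRing.Theory Num.Theory.
Import numFieldNormedType.Exports.

Local Open Scope classical_set_scope.
Local Open Scope ring_scope.
Local Open Scope quotient_scope.

Record subspaces (R : realType) (k m : nat) := Subspace {
  subspace_vs : {vspace 'rV[R]_m};
  _ : \dim subspace_vs == k }.

HB.instance Definition _ (R : realType) (k m : nat) :=
  [isSub for @subspace_vs R k m].

Definition full_rank (R : realType) (k m : nat) : set 'M[R]_(k, m) :=
  [set A | row_free A].
Arguments full_rank : clear implicits.

Definition row_span (R : realType) (k m : nat) (A : 'M[R]_(k, m)) :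
  {vspace 'rV[R]_m} := <<[seq row i A | i : 'I_k]>>%VS.

Lemma mem_row_span (R : realType) (k m : nat) (A : 'M[R]_(k, m)) (x : 'rV[R]_m) :
  (x \in row_span A) = (x <= A)%MS.
Proof.
apply/idP/idP => [xA|/submxP[D ->]].
  have -> : x = \sum_(i < size [seq row i A | i : 'I_k])
      coord (in_tuple [seq row i A | i : 'I_k]) i x *:
      [seq row i A | i : 'I_k]`_i.
    by rewrite {1}(coord_span (X := in_tuple _) xA).
  apply: summx_sub => i _; apply: scalemx_sub.
  have /mapP[j _ ->] := mem_nth 0 (ltn_ord i); exact: row_sub.
rewrite mulmx_sum_row; apply: memv_suml => i _; apply/memvZ/memv_span.
by apply/mapP; exists i; rewrite ?mem_enum.
Qed.

Lemma dim_row_span (R : realType) (k m : nat) (A : 'M[R]_(k, m)) :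
  row_free A -> \dim (row_span A) == k.
Proof.
move=> fA; have sz : size [seq row i A | i : 'I_k] = k.
  by rewrite size_map -cardE card_ord.
suff /eqP : free [seq row i A | i : 'I_k] by rewrite /row_span sz => ->.
rewrite -[[seq _ | _ in _]]/(tval (in_tuple _)).
apply/freeP => c c0 i.
pose D := \row_(j < k) c (cast_ord (esym sz) j).
have : D *m A = 0 *m A.
  rewrite mul0mx mulmx_sum_row -[RHS]c0 [RHS](reindex (cast_ord (esym sz))) /=.
    apply: eq_bigr => j _; rewrite mxE; congr (_ *: _).
    by rewrite (nth_map j) -?cardE ?card_ord// nth_ord_enum.
  by exists (cast_ord sz) => j _; rewrite ?cast_ordK ?cast_ordKV.
move/(row_free_inj fA)/rowP/(_ (cast_ord sz i)).
by rewrite !mxE cast_ordK.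
Qed.

Definition subspace_of (R : realType) (k m : nat)
    (A : full_rank R k m) : subspaces R k m :=
  Subspace (dim_row_span (set_mem (valP A))).

Lemma subspace_of_surj (R : realType) (k m : nat) (X : subspaces R k m) :
  exists A : full_rank R k m, subspace_of A = X.
Proof.
case: X => V dV; have /eqP dVk := dV.
pose A : 'M[R]_(k, m) := \matrix_(i < k) (vbasis V)`_i.
have AV : row_span A = V.
  rewrite -[RHS](span_basis (vbasisP V)) /row_span; congr span.
  apply: (@eq_from_nth _ 0).
    by rewrite size_map -cardE card_ord size_tuple dVk.
  move=> i; rewrite size_map -cardE card_ord => ik.
  by rewrite (nth_map (Ordinal ik)) -?cardE ?card_ord// rowK nth_enum_ord.
have fA : row_free A.
  rewrite -kermx_eq0; apply/eqP/row_matrixP => i; rewrite row0.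
  set u := row i _.
  have : u *m A = 0 by apply/sub_kermxP; exact: row_sub.
  rewrite mulmx_sum_row => u0; apply/rowP => j; rewrite [RHS]mxE.
  have /freeP fb := basis_free (vbasisP V).
  have s0 : \sum_(l < \dim V) u 0 (cast_ord dVk l) *: (vbasis V)`_l = 0.
    rewrite -[RHS]u0 [RHS](reindex (cast_ord dVk)) /=.
      by apply: eq_bigr => l _; rewrite rowK.
    by exists (cast_ord (esym dVk)) => l _; rewrite ?cast_ordK ?cast_ordKV.
  by have := fb _ s0 (cast_ord (esym dVk) j); rewrite cast_ordKV.
exists (exist _ A (mem_set fA)); exact/val_inj.
Qed.

Definition subspace_frame (R : realType) (k m : nat) (X : subspaces R k m) :
  full_rank R k m := sval (cid (subspace_of_surj X)).

Lemma subspace_frameK (R : realType) (k m : nat) :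
  cancel (@subspace_frame R k m) (@subspace_of R k m).
Proof. by move=> X; exact: (svalP (cid (subspace_of_surj X))). Qed.

HB.instance Definition _ (R : realType) (k m : nat) :=
  isQuotient.Build (full_rank R k m) (subspaces R k m) (@subspace_frameK R k m).

(* Gr(k, m) carries the quotient topology induced by the row-span map
   [subspace_of] from the space of full-rank k x m matrices. *)
Definition Gr (R : realType) (k m : nat) : topologicalType :=
  quotient_topology (subspaces R k m).

Definition Gr_ge0 (R : realType) (k m : nat) : set (Gr R k m) :=
  [set X | exists A : 'M[R]_(k, m),
     [/\ row_free A, row_span A = subspace_vs X &
         forall f : 'I_k -> 'I_m, {homo f : i j / (i < j)%N} ->
           0 <= \det (colsub f A)]].
Arguments Gr_ge0 : clear implicits.

(* Indices start at 0, so the sign (-1)^(i-1) of the i-th summand is (-1)^i. *)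
Definition formR (R : realType) (n : nat) (x y : 'rV[R]_(n + n)) : R :=
  \sum_(i < n) (-1) ^+ i * (x 0 (lshift n i) * y 0 (rshift n i)
                            - x 0 (rshift n i) * y 0 (lshift n i)).

Definition LGR (R : realType) (n : nat) : set (Gr R n (n + n)) :=
  [set X | forall x y, x \in subspace_vs X -> y \in subspace_vs X ->
     formR x y = 0].
Arguments LGR : clear implicits.

Definition LGR_ge0 (R : realType) (n : nat) : set (Gr R n (n + n)) :=
  LGR R n `&` Gr_ge0 R n (n + n).
Arguments LGR_ge0 : clear implicits.

Definition totally_nonneg (R : realType) (n : nat) (M : 'M[R]_n) : Prop :=
  forall (p : nat) (f g : 'I_p -> 'I_n),
    {homo f : i j / (i < j)%N} -> {homo g : i j / (i < j)%N} ->
    0 <= \det (mxsub f g M).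

(* [rev_ord] is i |-> n + 1 - i on 1-based indices. *)
Definition antidiag_sym (R : realType) (n : nat) (M : 'M[R]_n) : Prop :=
  forall i j, M i j = M (rev_ord j) (rev_ord i).

(* The 0-based value of [rev_ord i] is n - 1 - i, which is the exponent n - i
   for the corresponding 1-based i. *)
Definition sigma_mx (R : realType) (n : nat) (M : 'M[R]_n) : 'M[R]_(n, n + n) :=
  row_mx 1%:M (\matrix_(i, j) ((-1) ^+ rev_ord i * M (rev_ord i) j)).

Lemma sigma_mx_free (R : realType) (n : nat) (M : 'M[R]_n) :
  row_free (sigma_mx M).
Proof.
apply/row_freeP; exists (col_mx 1%:M 0).
by rewrite mul_row_col mulmx1 mulmx0 addr0.
Qed.

Definition sigma (R : realType) (n : nat) (M : 'M[R]_n) : Gr R n (n + n) :=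
  Subspace (dim_row_span (sigma_mx_free M)).

Definition tnn_sym (R : realType) (n : nat) : set 'M[R]_n :=
  [set M | totally_nonneg M /\ antidiag_sym M].
Arguments tnn_sym : clear implicits.

Definition embedding (X Y : topologicalType) (f : X -> Y) : Prop :=
  [/\ injective f, continuous f &
      forall U : set X, open U ->
        exists2 V : set Y, open V & f @` U = range f `&` V].

(* Main.v *)
Require Import Defs.
From HB Require Import structures.
From mathcomp Require Import all_boot all_order all_algebra perm.
From mathcomp Require Import all_classical all_reals all_analysis.

Set Implicit Arguments.
Unset Strict Implicit.
Unset Printing Implicit Defensive.

Import Order.TTheory GRing.Theory Num.Theory.
Import numFieldNormedType.Exports.

Local Open Scope classical_set_scope.
Local Open Scope ring_scope.

(* Parts (1) and (2) are computations with the frame (I | M'): the Gram matrix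
   of R on its rows vanishes iff M is symmetric with respect to the
   antidiagonal, and its maximal minors are exactly the minors of M, the signs
   in M' being there to absorb those of the Laplace expansion.

   The image of sigma is the open cell where the leading maximal minor does not
   vanish, with inverse chart A |-> A_left^-1 A_right.  For density, start from a
   Lagrangian frame A with nonnegative maximal minors, one of which, on the
   columns f, is positive.  Adding t times column k+1 to column k keeps maximal
   minors nonnegative, and so does a second such move, on the columns paired
   with these by R (cyclically, up to the sign (-1)^(n-1)); together the two
   moves preserve R.  If f is not [0, n), some k+1 in f can be replaced by k,
   and after the moves, for t > 0 as small as we wish, the maximal minor on the
   new columns is positive.  Iterating brings f to [0, n). *)

(** * Increasing maps between finite ordinals *)

Lemma rev_ord_decr n : {homo @rev_ord n : i j / (i < j)%N >-> (j < i)%N}.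
Proof.
by move=> i j ij; apply: ltn_sub2l => //; apply: leq_ltn_trans (ltn_ord j).
Qed.

Lemma incr_inj q m (h : 'I_q -> 'I_m) :
  {homo h : i j / (i < j)%N} -> injective h.
Proof.
move=> hh i j e; case: (ltngtP i j) => [/hh|/hh|/val_inj//]; by rewrite e ltnn.
Qed.

Lemma incr_leq q m (h : 'I_q -> 'I_m) :
  {homo h : i j / (i < j)%N} -> forall i : 'I_q, (i <= h i)%N.
Proof.
move=> hh [i]; elim: i => // i IH iq /=.
by apply: leq_ltn_trans (IH (ltnW iq)) _; apply: hh.
Qed.

(** The bound of [incr_leq], applied to [h] and to its conjugate by [rev_ord], squeezes [h i] from
    both sides. *)
Lemma incr_id m (h : 'I_m -> 'I_m) :
  {homo h : i j / (i < j)%N} -> h =1 id.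
Proof.
move=> hh i; apply/val_inj/eqP; rewrite eqn_leq (incr_leq hh) andbT.
pose h' j := rev_ord (h (rev_ord j)).
have h'h : {homo h' : i j / (i < j)%N}.
  by move=> a b ab; apply/rev_ord_decr/hh/rev_ord_decr.
have := incr_leq h'h (rev_ord i); rewrite /h' rev_ordK /=.
by rewrite leq_sub2lE.
Qed.

Lemma incr_enum m (A : {set 'I_m}) p : #|A| = p ->
  exists2 c : 'I_p -> 'I_m, {homo c : i j / (i < j)%N} &
    forall x, (x \in A) = (x \in codom c).
Proof.
move=> <-; exists (@enum_val _ (mem A)).
  have srt : sorted ltn (map val (enum A)).
    rewrite /enum_mem -enumT.
    apply: (@subseq_sorted _ _ ltn_trans _ (map val (enum 'I_m))).
      exact/map_subseq/filter_subseq.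
    by rewrite val_enum_ord iota_ltn_sorted.
  move=> i j ij; have x0 := enum_val i.
  rewrite !(enum_val_nth x0) -!(nth_map x0 0%N) -?cardE//.
  by rewrite (sorted_ltn_nth ltn_trans)// inE size_map -cardE.
move=> x; apply/idP/codomP => [xA|[i ->]]; last exact: enum_valP.
by exists (enum_rank_in xA x); rewrite enum_rankK_in.
Qed.

Lemma incr_compl p q (h : 'I_q -> 'I_(p + q)) : injective h ->
  exists2 c : 'I_p -> 'I_(p + q), {homo c : i j / (i < j)%N} &
    forall i j, c i != h j.
Proof.
move=> hi; have [|c c_incr cP] := @incr_enum _ (~: [set h i | i in 'I_q]) p.
  by rewrite cardsCs finset.setCK card_imset// !card_ord addnK.
exists c => // i j; have := cP (c i); rewrite codom_f inE => /negP H.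
by apply/eqP => e; apply: H; rewrite e imset_f.
Qed.

Lemma downset_split n (P : pred 'I_n) :
  (forall i j : 'I_n, (i < j)%N -> P j -> P i) ->
  exists2 p, (p <= n)%N & forall i : 'I_n, P i = (i < p)%N.
Proof.
elim: n P => [|n IH] P dP; first by exists 0%N => // -[].
have [Pm|nPm] := boolP (P ord_max).
  exists n.+1 => // i; rewrite ltn_ord.
  case: (ltngtP i n) => [||e]; [by move=> li; rewrite (dP i ord_max)| | ].
    by rewrite ltnNge -ltnS ltn_ord.
  by have -> : i = ord_max by apply/val_inj.
have [|p pn pP] := IH (P \o lift ord_max).
  by move=> i j ij; apply: dP; rewrite !lift_max.
exists p => [|i]; first exact: leqW.
have [j ->|->] := unliftP ord_max i; first by rewrite lift_max -pP.
by rewrite (negbTE nPm) ltnNge pn.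
Qed.

(** * Determinants with a signed antidiagonal block *)

Section AntidiagonalBlock.
Variable R : comNzRingType.

(* Since [r] is decreasing, deleting row [r 0] does not shift the rows
   [r 1, r 2, ...], and the sign of each entry cancels that of its cofactor. *)
Lemma det_row_mx_signed_delta p q (r : 'I_p -> 'I_(p + q))
    (h : 'I_q -> 'I_(p + q)) (B : 'M[R]_(p + q, q)) :
    {homo r : i j / (i < j)%N >-> (j < i)%N} ->
    {homo h : i j / (i < j)%N} -> (forall i j, r i != h j) ->
  \det (row_mx (\matrix_(i, k) ((-1) ^+ i *+ (i == r k))) B) =
  \det (rowsub h B).
Proof.
elim: p q r h B => [|p IH] q r h B rD hI rh.
  have hid := incr_id hI; congr (\det _); apply/matrixP => i j.
  rewrite !mxE; case: splitP => [[]//|k jk]; rewrite hid; congr (B _ _).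
  exact/val_inj.
rewrite (expand_det_col _ (lshift q ord0)) (bigD1 (r ord0))//= big1 ?addr0; last first.
  by move=> i ir; rewrite row_mxEl mxE (negbTE ir) mul0r.
rewrite row_mxEl mxE eqxx mulr1n /cofactor /= addn0 mulrA -expr2 sqrr_sign mul1r.
have r'E (k : 'I_p) : exists2 j : 'I_(p + q), r (lift ord0 k) = lift (r ord0) j &
   val j = val (r (lift ord0 k)).
  have lt0 : (r (lift ord0 k) < r ord0)%N by apply: rD.
  have [j e|e] := unliftP (r ord0) (r (lift ord0 k)); last by rewrite e ltnn in lt0.
  exists j => //; rewrite e /= /bump; move: lt0; rewrite e /= /bump.
  case: (leqP (r ord0) j) => //= rj; rewrite add1n => /ltnW jr.
  by rewrite ltnNge rj in jr.
have h'E (k : 'I_q) : exists j : 'I_(p + q), h k = lift (r ord0) j.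
  have [j e|e] := unliftP (r ord0) (h k); first by exists j.
  by have := rh ord0 k; rewrite e eqxx.
have [r' r'1 r'2] := fin_all_exists2 r'E; have [h' h'1] := fin_all_exists h'E.
transitivity (\det (row_mx (\matrix_(i, k) ((-1) ^+ i *+ (i == r' k)))
                           (row' (r ord0) B))).
  congr (\det _); apply/matrixP => i j; rewrite !mxE.
  have ltr (k : 'I_p) : (r' k < r ord0)%N by rewrite [X in (X < _)%N]r'2; apply: rD.
  case: splitP => k jk; case: splitP => l jl; rewrite !mxE.
  - have -> : k = lift ord0 l.
      by apply/val_inj; rewrite /= -jk -jl.
    rewrite r'1 (inj_eq lift_inj); case: eqP => [->|]; last by rewrite !mulr0n.
    by rewrite -r'1 -[nat_of_ord (r _)]r'2.
  - by have := ltn_ord k; rewrite -jk /= /bump leq0n jl add1n ltnS ltnNge leq_addr.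
  - have := ltn_ord l; rewrite -jl; move: jk; rewrite /= /bump leq0n !add1n.
    by rewrite addSn => -[->]; rewrite ltnNge leq_addr.
  - congr (B _ _); apply/val_inj/eqP; rewrite /= -(eqn_add2l p.+1) -jk /= /bump leq0n jl.
    by rewrite !add1n addSn.
rewrite (IH _ _ h').
- by congr (\det _); apply/matrixP => i j; rewrite !mxE h'1.
- by move=> i j ij; rewrite [X in (X < _)%N]r'2 [X in (_ < X)%N]r'2; apply: rD.
- by move=> i j /hI; rewrite !h'1 /= !ltnNge leq_bump2.
- by move=> i j; apply: contraNneq (rh (lift ord0 i) j) => e; rewrite r'1 h'1 e.
Qed.

(** Expansion along the first column: its only nonzero entry is in the last row, and the sign there
    cancels that of its cofactor. *)
Lemma det_antidiag n :
  \det (\matrix_(i, j) ((-1) ^+ i *+ (i == rev_ord j)) : 'M[R]_n) = 1.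
Proof.
elim: n => [|n IH]; first by rewrite det_mx00.
rewrite (expand_det_col _ ord0) (bigD1 ord_max)//= big1 ?addr0; last first.
  move=> i im; rewrite mxE; case: eqP => e; last by rewrite mul0r.
  by case/eqP: im; rewrite e; apply/val_inj; rewrite /= subn1.
rewrite mxE /cofactor /= addn0.
have -> : ord_max == rev_ord ord0 :> 'I_n.+1 by apply/eqP/val_inj; rewrite /= subn1.
rewrite mulr1n mulrA -expr2 sqrr_sign mul1r -[RHS]IH; congr (\det _).
apply/matrixP => i j; rewrite !mxE lift_max; congr (_ *+ _).
congr nat_of_bool; rewrite -!val_eqE /= /bump leq0n add1n subSS.
by rewrite leqNgt ltn_ord.
Qed.

End AntidiagonalBlock.

(** * Maximal minors of [(I | M')] as minors of [M] *)

Definition glue_cols p q n (s : 'I_p -> 'I_n) (g : 'I_q -> 'I_n) (i : 'I_(p + q)) :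
  'I_(n + n) :=
  match fintype.split i with inl k => lshift n (s k) | inr l => rshift n (g l) end.

Lemma glue_cols_incr p q n (s : 'I_p -> 'I_n) (g : 'I_q -> 'I_n) :
  {homo s : i j / (i < j)%N} -> {homo g : i j / (i < j)%N} ->
  {homo glue_cols s g : i j / (i < j)%N}.
Proof.
move=> sI gI i j; rewrite /glue_cols.
case: (fintype.splitP i) => k ik; case: (fintype.splitP j) => l jl; rewrite ik jl.
- exact: sI.
- by move=> _; apply: leq_trans (ltn_ord (s k)) _; rewrite leq_addr.
- by rewrite ltnNge (leq_trans (ltnW (ltn_ord l)))// leq_addr.
- by rewrite !ltn_add2l => /gI.
Qed.

(** Since [f] increases, the positions that it sends to the left half form an initial segment; [p]
    is its length. *)
Lemma incr_glue_cols n (f : 'I_n -> 'I_(n + n)) : {homo f : i j / (i < j)%N} ->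
  exists p q (e : (p + q)%N = n) (s : 'I_p -> 'I_n) (g : 'I_q -> 'I_n),
    [/\ {homo s : i j / (i < j)%N}, {homo g : i j / (i < j)%N} &
        forall i, f (cast_ord e i) = glue_cols s g i].
Proof.
move=> fI; have [|p pn pP] := @downset_split n (fun i => (f i < n)%N).
  by move=> i j /fI; apply: ltn_trans.
have [q e] : exists q, (p + q)%N = n by exists (n - p)%N; rewrite subnKC.
exists p, q, e.
have sE k : exists x, f (cast_ord e (lshift q k)) = lshift n x.
  have := pP (cast_ord e (lshift q k)); rewrite /= ltn_ord.
  case: (fintype.splitP (f (cast_ord e (lshift q k)))) => x xE.
    by exists x; apply/val_inj.
  by [].
have gE k : exists x, f (cast_ord e (rshift p k)) = rshift n x.
  have := pP (cast_ord e (rshift p k)); rewrite /= [X in _ = X]ltnNge leq_addr.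
  case: (fintype.splitP (f (cast_ord e (rshift p k)))) => x xE.
    by [].
  by exists x; apply/val_inj.
have [s {}sE] := fin_all_exists sE; have [g {}gE] := fin_all_exists gE.
exists s, g; split=> [i j ij|i j ij|i].
- suff : (lshift n (s i) < lshift n (s j))%N by [].
  by rewrite -!sE; apply: fI.
- suff : (rshift n (g i) < rshift n (g j))%N by rewrite ltn_add2l.
  by rewrite -!gE; apply: fI; rewrite /= ltn_add2l.
- rewrite /glue_cols; case: (fintype.splitP i) => k ik.
    by rewrite -sE; congr f; apply/val_inj.
  by rewrite -gE; congr f; apply/val_inj.
Qed.

(** The frame is [K] times [(D | M)], where [D] is the signed antidiagonal matrix and [K] its
    inverse, of determinant 1. In a minor of [(D | M)] the columns [s] of [D] delete from [M] the
    rows [rev_ord (s i)], and [h] lists the rows that remain. *)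
Lemma minor_sigma_mx (R : realType) p q (M : 'M[R]_(p + q))
    (s : 'I_p -> 'I_(p + q)) (h g : 'I_q -> 'I_(p + q)) :
  {homo s : i j / (i < j)%N} -> {homo h : i j / (i < j)%N} ->
  (forall i j, rev_ord (s i) != h j) ->
  \det (colsub (glue_cols s g) (sigma_mx M)) = \det (mxsub h g M).
Proof.
move=> sI hI sh.
pose D : 'M[R]_(p + q) := \matrix_(i, j) ((-1) ^+ i *+ (i == rev_ord j)).
pose K : 'M[R]_(p + q) := \matrix_(i, j) ((-1) ^+ rev_ord i *+ (j == rev_ord i)).
have KM m (X : 'M[R]_(p + q, m)) i j : (K *m X) i j = (-1) ^+ rev_ord i * X (rev_ord i) j.
  rewrite mxE (bigD1 (rev_ord i))//= big1 ?addr0 ?mxE ?eqxx// => k ki.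
  by rewrite mxE (negbTE ki) mul0r.
have KD : K *m D = 1%:M.
  apply/matrixP => i j; rewrite KM !mxE (inj_eq rev_ord_inj).
  by case: eqP => _; rewrite ?mulr0// -expr2 sqrr_sign.
have K1 : \det K = 1.
  by have := congr1 (fun A => \det A) KD; rewrite det_mulmx det_antidiag mulr1 det1.
have -> : sigma_mx M = K *m row_mx D M.
  rewrite mul_mx_row KD; congr row_mx; apply/matrixP => i j.
  by rewrite KM mxE.
rewrite -mulmx_colsub det_mulmx K1 mul1r.
have -> : mxsub h g M = rowsub h (colsub g M) by apply/matrixP => i j; rewrite !mxE.
rewrite -(@det_row_mx_signed_delta _ _ _ (fun i => rev_ord (s i)))//; last first.
  by move=> i j /sI; exact: rev_ord_decr.
congr (\det _); apply/matrixP => i j; rewrite [LHS]mxE /glue_cols.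
case: (fintype.splitP j) => k jk.
  have -> : j = lshift q k by apply/val_inj.
  by rewrite !row_mxEl !mxE.
have -> : j = rshift p k by apply/val_inj.
by rewrite !row_mxEr !mxE.
Qed.

Lemma row_span_mulmx (R : realType) k m (A B : 'M[R]_(k, m)) :
  row_span A = row_span B -> exists D, A = D *m B.
Proof.
move=> AB; apply/submxP/row_subP => i.
by rewrite -mem_row_span -AB mem_row_span row_sub.
Qed.

(** A change of frame multiplies all maximal minors by the same nonzero determinant, so one positive
    minor decides the sign of this factor. *)
Lemma Gr_ge0_minors (R : realType) k m (A : 'M[R]_(k, m)) (fA : row_free A)
    (f0 : 'I_k -> 'I_m) :
  {homo f0 : i j / (i < j)%N} -> 0 < \det (colsub f0 A) ->
  Gr_ge0 R k m (Subspace (dim_row_span fA)) ->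
  forall f : 'I_k -> 'I_m, {homo f : i j / (i < j)%N} -> 0 <= \det (colsub f A).
Proof.
move=> f0I A0 [B [fB /= /row_span_mulmx[D BE] B0]] f fI.
have mB g : \det (colsub g B) = \det D * \det (colsub g A).
  by rewrite BE -mulmx_colsub det_mulmx.
have D0 : 0 < \det D.
  rewrite lt_neqAle -(pmulr_lge0 _ A0) -mB B0// andbT eq_sym.
  have [C] := row_freeP fB; rewrite BE -mulmxA => /(congr1 determinant).
  rewrite det_mulmx det1 => DC.
  by apply/eqP => D0; move: DC; rewrite D0 mul0r => /esym/eqP; rewrite oner_eq0.
by have := B0 f fI; rewrite mB pmulr_rge0.
Qed.

Lemma lsubmx_sigma (R : realType) n (M : 'M[R]_n) :
  colsub (@lshift n n) (sigma_mx M) = 1%:M.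
Proof. by apply/matrixP => i j; rewrite mxE row_mxEl. Qed.

Lemma Gr_ge0_sigma (R : realType) n (M : 'M[R]_n) :
  Gr_ge0 R n (n + n) (sigma M) <-> totally_nonneg M.
Proof.
split=> [M0 q h g hI gI|M0].
  have [p e] : exists p, (p + q)%N = n.
    exists (n - q)%N; apply: subnK.
    by have := leq_card h (incr_inj hI); rewrite !card_ord.
  subst n; have [c cI ch] := incr_compl (incr_inj hI).
  (* Reversing on both sides keeps [s] increasing, while [rev_ord (s i)] runs over the rows outside
     the image of [h]. *)
  pose s i := rev_ord (c (rev_ord i)).
  have sI : {homo s : i j / (i < j)%N}.
    by move=> i j ij; apply/rev_ord_decr/cI/rev_ord_decr.
  rewrite -(@minor_sigma_mx _ _ _ _ s).
  (* The identity block is the positive minor that [Gr_ge0_minors] asks for. *)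
  - apply: (Gr_ge0_minors (f0 := @lshift (p + q) (p + q)) _ _ M0) => //.
      by rewrite lsubmx_sigma det1.
    by apply: glue_cols_incr.
  - exact: sI.
  - exact: hI.
  - by move=> i j; rewrite /s rev_ordK.
exists (sigma_mx M); split=> //; first exact: sigma_mx_free.
move=> f /incr_glue_cols[p [q [e [s [g [sI gI fE]]]]]]; subst n.
have [|h hI hP] := @incr_enum _ (~: [set rev_ord (s i) | i in 'I_p]) q.
  rewrite cardsCs finset.setCK card_imset ?card_ord ?addKn//.
  by move=> i j /rev_ord_inj /(incr_inj sI).
have -> : colsub f (sigma_mx M) = colsub (glue_cols s g) (sigma_mx M).
  by apply/matrixP => i j; rewrite !mxE -fE cast_ord_id.
rewrite (@minor_sigma_mx _ _ _ _ _ h)//; first exact: M0.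
move=> i j; have := hP (h j); rewrite codom_f inE => /negP H.
by apply/eqP => hj; apply: H; apply/imsetP; exists i.
Qed.

(** * The form R through its Gram matrix, and antidiagonal symmetry *)

Definition formR_mx (R : realType) n : 'M[R]_(n + n) :=
  let S := diag_mx (\row_(i < n) (-1) ^+ i) in block_mx 0 S (- S) 0.
Arguments formR_mx : clear implicits.

Lemma formR_mxE (R : realType) n (x y : 'rV[R]_(n + n)) :
  formR x y = (x *m formR_mx R n *m y^T) 0 0.
Proof.
rewrite -[x]hsubmxK -[y]hsubmxK /formR_mx mul_row_block !mulmx0 add0r addr0.
rewrite tr_row_mx mul_row_col mulmxN mulNmx addrC mxE [X in _ + X]mxE !mul_mx_diag.
rewrite !mxE -sumrB; apply: eq_bigr => i _.
by rewrite !row_mxEl !row_mxEr !mxE mulrBr; congr (_ - _); rewrite mulrA [_ * (-1) ^+ _]mulrC.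
Qed.

Lemma tr_formR_mx (R : realType) n : (formR_mx R n)^T = - formR_mx R n.
Proof.
by rewrite /formR_mx tr_block_mx opp_block_mx !trmx0 linearN /= tr_diag_mx opprK oppr0.
Qed.

Lemma LGR_row_span (R : realType) n (A : 'M[R]_(n, n + n)) (fA : row_free A) :
  LGR R n (Subspace (dim_row_span fA)) <-> A *m formR_mx R n *m A^T = 0.
Proof.
split=> [LA|A0 x y]; last first.
  rewrite /= !mem_row_span => /submxP[u ->] /submxP[v ->].
  rewrite formR_mxE trmx_mul -!mulmxA [A *m (_ *m _)]mulmxA.
  by rewrite [A *m formR_mx R n *m _]mulmxA A0 mul0mx mulmx0 mxE.
apply/matrixP => i j; rewrite [RHS]mxE.
have := LA (row i A) (row j A); rewrite formR_mxE /= !mem_row_span !row_sub.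
move=> /(_ isT isT) <-; rewrite tr_row -row_mul [LHS]mxE [RHS]mxE.
by apply: eq_bigr => k _; congr (_ * _); rewrite [RHS]mxE.
Qed.

(** With [S] the diagonal matrix of the signs in [formR], the frame [(I | M')] is isotropic iff the
    product of [M'] and [S] is symmetric. As [rev_ord j + j = n - 1], the signs on both sides agree
    and cancel, leaving that [M] with its rows reversed is symmetric. *)
Lemma LGR_sigma (R : realType) n (M : 'M[R]_n) :
  LGR R n (sigma M) <-> antidiag_sym M.
Proof.
set M' := \matrix_(i, j) ((-1) ^+ rev_ord i * M (rev_ord i) j).
have E : LGR R n (sigma M) <->
    forall i j, M' j i * (-1) ^+ i = (-1) ^+ j * M' i j.
  rewrite LGR_row_span /sigma_mx -/M' /formR_mx mul_row_block !mulmx0 add0r addr0.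
  rewrite mul1mx tr_row_mx trmx1 mul_row_col mulmx1 mulmxN addrC.
  rewrite mul_diag_mx mul_mx_diag; split=> [/matrixP H i j|H].
    by have /eqP := H j i; rewrite !mxE subr_eq0 => /eqP.
  by apply/matrixP => i j; have := H j i; rewrite !mxE => ->; rewrite subrr.
have rev_sign (j : 'I_n) : (-1) ^+ rev_ord j = (-1) ^+ n.-1 * (-1) ^+ j :> R.
  have <- : (rev_ord j + j)%N = n.-1.
    by have /(congr1 predn) := subnK (ltn_ord j); rewrite addnS.
  by rewrite exprD -mulrA -expr2 sqrr_sign mulr1.
have {}E : LGR R n (sigma M) <-> forall i j, M (rev_ord j) i = M (rev_ord i) j.
  have M'E i j : M' j i * (-1) ^+ i =
      (-1) ^+ n.-1 * (-1) ^+ j * (-1) ^+ i * M (rev_ord j) i.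
    by rewrite mxE rev_sign mulrAC.
  rewrite E; split=> H i j; have := H i j.
    rewrite M'E [X in _ = X]mulrC M'E [_ * (-1) ^+ i * (-1) ^+ j]mulrAC.
    by apply: mulfI; rewrite !mulf_neq0 ?signr_eq0.
  by rewrite M'E [X in _ -> _ = X]mulrC M'E => ->; rewrite [_ * (-1) ^+ i * (-1) ^+ j]mulrAC.
rewrite E; split=> [H i j|H i j]; first by rewrite H rev_ordK.
by rewrite H rev_ordK.
Qed.

(** * Column moves that keep maximal minors nonnegative *)

Definition fun_replace n m (f : 'I_n -> 'I_m) (j : 'I_n) (a : 'I_m) : 'I_n -> 'I_m :=
  fun k => if k == j then a else f k.

Lemma col_addE (R : nzRingType) n m (A : 'M[R]_(n, m)) t a b i j :
  (A + t *: (A *m delta_mx a b)) i j = A i j + t * A i a *+ (j == b).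
Proof.
rewrite !mxE (bigD1 a)//= big1 ?addr0 => [|k ka]; rewrite mxE.
  by rewrite eqxx /= mulr_natr mulrnAr.
by rewrite (negbTE ka) mulr0.
Qed.

Lemma det_col_add_notin (R : comNzRingType) n m (A : 'M[R]_(n, m)) t a b
    (f : 'I_n -> 'I_m) : (forall j, f j != b) ->
  \det (colsub f (A + t *: (A *m delta_mx a b))) = \det (colsub f A).
Proof.
move=> fb; congr (\det _); apply/matrixP => i j.
by rewrite mxE col_addE mxE (negbTE (fb j)) mulr0n addr0.
Qed.

(** Linearity of the determinant in column [j]; injectivity of [f] ensures that the modified column
    is picked only there. *)
Lemma det_col_add (R : comNzRingType) n m (A : 'M[R]_(n, m)) t a
    (f : 'I_n -> 'I_m) j : injective f ->
  \det (colsub f (A + t *: (A *m delta_mx a (f j)))) =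
  \det (colsub f A) + t * \det (colsub (fun_replace f j a) A).
Proof.
move=> fI; rewrite -[LHS]det_tr -[X in _ = X + _]det_tr -[X in _ + t * X]det_tr.
rewrite -[X in _ = X + _]mul1r; apply: (@determinant_multilinear _ _ _ _ _ j).
- apply/rowP => k; rewrite [LHS]mxE [LHS]mxE mxE col_addE eqxx mulr1n !mxE.
  by rewrite /fun_replace eqxx mul1r.
- apply/matrixP => k l; rewrite [LHS]mxE [LHS]mxE [LHS]mxE [RHS]mxE [RHS]mxE [RHS]mxE.
  by rewrite col_addE (inj_eq fI) eq_sym (negbTE (neq_lift _ _)) mulr0n addr0.
- apply/matrixP => k l; rewrite [LHS]mxE [LHS]mxE [LHS]mxE [RHS]mxE [RHS]mxE [RHS]mxE.
  by rewrite col_addE (inj_eq fI) /fun_replace eq_sym (negbTE (neq_lift _ _)) mulr0n addr0.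
Qed.

Lemma det_replace_in (R : comNzRingType) n m (A : 'M[R]_(n, m))
    (f : 'I_n -> 'I_m) j k : k != j ->
  \det (colsub (fun_replace f j (f k)) A) = 0.
Proof.
move=> kj; rewrite -det_tr; apply: (determinant_alternate kj) => i.
by rewrite !mxE /fun_replace eqxx (negbTE kj).
Qed.

Definition nonneg_minors (R : numDomainType) n m (A : 'M[R]_(n, m)) :=
  forall f : 'I_n -> 'I_m, {homo f : i j / (i < j)%N} -> 0 <= \det (colsub f A).

(* Adding a positive multiple of [s] times column [a] to column [b] adds
   maximal minors to maximal minors. *)
Definition positive_move (R : numDomainType) n m (a b : 'I_m) (s : R) :=
  forall (f : 'I_n -> 'I_m) j, {homo f : i j / (i < j)%N} ->
  f j = b -> (forall k, f k != a) ->
  exists2 f' : 'I_n -> 'I_m, {homo f' : i j / (i < j)%N} &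
    forall A : 'M[R]_(n, m),
      s * \det (colsub (fun_replace f j a) A) = \det (colsub f' A).

(** A value that moves to a free neighbouring place cannot pass any other value. *)
Lemma fun_replace_adjacent_incr n m (f : 'I_n -> 'I_m) j (a : 'I_m) :
  {homo f : i j / (i < j)%N} -> (a = (f j).+1 :> nat \/ f j = a.+1 :> nat) ->
  (forall k, f k != a) -> {homo fun_replace f j a : i j / (i < j)%N}.
Proof.
move=> fI ab fa x y xy; rewrite /fun_replace.
have fan k : f k != a :> nat by exact: fa.
case: (eqVneq x j) => [xj|xj]; case: (eqVneq y j) => [yj|yj]; last exact: fI.
- by rewrite xj yj ltnn in xy.
- rewrite xj in xy; have := fI _ _ xy; have := fan y.
  case: ab => [->|-> _]; last exact: ltnW.
  by rewrite [(_.+1 < _)%N]ltn_neqAle eq_sym => -> ->.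
- rewrite yj in xy; have := fI _ _ xy; have := fan x.
  case: ab => [->|-> ]; first by move=> _; exact: leqW.
  by rewrite ltnS [(_ < a)%N]ltn_neqAle => -> ->.
Qed.

Lemma positive_move_adjacent (R : numDomainType) n m (a b : 'I_m) :
  (a = b.+1 :> nat \/ b = a.+1 :> nat) -> @positive_move R n m a b 1.
Proof.
move=> ab f j fI fj fa; exists (fun_replace f j a) => [|A]; last by rewrite mul1r.
by apply: fun_replace_adjacent_incr => //; rewrite fj.
Qed.

(** The replaced column comes first but carries the largest index. Bringing it to the end is a
    cyclic permutation of [n] columns, of sign [(-1) ^+ n.-1]; the proof compares the expansions
    along the first and the last column. *)
Lemma positive_move_wrap (R : numDomainType) n m (a b : 'I_m) :
  a.+1 = m -> b = 0%N :> nat ->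
  @positive_move R n m a b ((-1) ^+ n.-1).
Proof.
move=> am b0 f j fI fj fa.
case: n j f fI fj fa => [[]//|n] j f fI fj fa.
have -> : j = ord0.
  by apply/val_inj/eqP; rewrite -leqn0 -b0 -fj incr_leq.
pose f' i := if unlift ord_max i is Some k then f (lift ord0 k) else a.
exists f' => [x y|A].
  rewrite /f'; case: (unliftP ord_max x) => [k ->|->]; last first.
    by rewrite ltnNge -ltnS ltn_ord.
  case: (unliftP ord_max y) => [l ->|->] xy.
    by apply: fI; move: xy; rewrite !lift_max /= /bump !leq0n.
  rewrite ltn_neqAle -ltnS am ltn_ord andbT.
  exact: fa.
rewrite (expand_det_col _ ord0) (expand_det_col _ ord_max) big_distrr /=.
apply: eq_bigr => i _; rewrite !mxE /fun_replace eqxx /f' unlift_none.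
rewrite mulrCA /cofactor addn0 exprD -mulrA.
congr (_ * _); rewrite mulrCA; congr (_ * (_ * \det _)).
apply/matrixP => k l; rewrite !mxE eq_sym (negbTE (neq_lift _ _)).
by rewrite liftK.
Qed.

(** The minor changes only if [b] is picked. The increment is then zero if [a] is picked too, by a
    repeated column, and otherwise [t] times a maximal minor of [A]. *)
Lemma det_le_positive_move (R : numDomainType) n m (A : 'M[R]_(n, m)) a b s t
    (f : 'I_n -> 'I_m) :
  a != b -> positive_move n a b s -> nonneg_minors A -> 0 <= t ->
  {homo f : i j / (i < j)%N} ->
  \det (colsub f A) <= \det (colsub f (A + (t * s) *: (A *m delta_mx a b))).
Proof.
move=> ab abs A0 t0 fI.
have [[j fj]|fb] := pselect (exists j, f j = b); last first.
  rewrite det_col_add_notin// => j; apply/eqP => fj; apply: fb; by exists j.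
rewrite -fj det_col_add; last exact: incr_inj.
rewrite lerDl -mulrA; apply: mulr_ge0 => //.
have [[k fk]|fa] := pselect (exists k, f k = a).
  rewrite -fk det_replace_in ?mulr0//.
  by apply: contraNneq ab => kj; rewrite -fk kj fj.
have [|f' f'I ->] := abs f j fI fj; last exact: A0.
by move=> k; apply/eqP => fk; apply: fa; exists k.
Qed.

(** The new minor is the old one on the same columns, which is nonnegative, plus [t] times the
    positive minor on [f]. *)
Lemma positive_move_gt0 (R : numDomainType) n m (A : 'M[R]_(n, m)) (a : 'I_m) t
    (f : 'I_n -> 'I_m) j :
  {homo f : i j / (i < j)%N} -> f j = a.+1 :> nat -> (forall k, f k != a) ->
  nonneg_minors A -> 0 < t -> 0 < \det (colsub f A) ->
  0 < \det (colsub (fun_replace f j a) (A + t *: (A *m delta_mx (f j) a))).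
Proof.
move=> fI fj fa A0 t0 Af; have f'I : {homo fun_replace f j a : i j / (i < j)%N}.
  by apply: fun_replace_adjacent_incr => //; right.
rewrite -{2}[a](_ : fun_replace f j a j = a); last by rewrite /fun_replace eqxx.
rewrite det_col_add; last exact: incr_inj.
rewrite ltr_wpDl ?A0// mulr_gt0// (_ : colsub _ _ = colsub f A)//.
by apply/matrixP => x y; rewrite !mxE /fun_replace; case: eqP => [->|].
Qed.

(** * Moves that preserve the form R *)

Lemma row_formR_mx (R : realType) n (i : 'I_n) :
  (row (lshift n i) (formR_mx R n) = (-1) ^+ i *: delta_mx 0 (rshift n i)) *
  (row (rshift n i) (formR_mx R n) = - (-1) ^+ i *: delta_mx 0 (lshift n i)).
Proof.
rewrite /formR_mx /block_mx rowKu rowKd !row_row_mx raddfN /= !row0 row_diag_mx mxE.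
rewrite delta_mx_rshift delta_mx_lshift !scale_row_mx !scaler0 scaleNr.
by split.
Qed.

Lemma mul_delta_row (R : comNzRingType) m n p (A : 'M[R]_(n, p)) (a : 'I_m) b c j :
  row b A = c *: delta_mx 0 j -> delta_mx a b *m A = c *: delta_mx a j.
Proof.
move=> bA; rewrite -(mul_delta_mx (0 : 'I_1)) -mulmxA -rowE bA -scalemxAr.
by rewrite mul_delta_mx.
Qed.

(* Infinitesimally, adding column [b.+1] to column [b] becomes an isometry of
   [formR] once it is completed by the move between the columns paired with
   them, which wraps around from the last column to the first when [b.+1 = n]. *)
Lemma lagrangian_move (R : realType) n (a b : 'I_(n + n)) : a = b.+1 :> nat ->
  exists X : 'M[R]_(n + n),
  [/\ (X *m formR_mx R n)^T = X *m formR_mx R n, X *m X = 0 &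
     forall (A : 'M[R]_(n, n + n)) t, nonneg_minors A -> 0 <= t ->
     forall f : 'I_n -> 'I_(n + n), {homo f : i j / (i < j)%N} ->
       \det (colsub f (A + t *: (A *m delta_mx a b))) <=
       \det (colsub f (A + t *: (A *m X)))].
Proof.
move=> ab.
(* R pairs [a'] with [b] and [b'] with [a]. For [X = delta_mx a b + s *: delta_mx a' b'], the
   product with the Gram matrix has coefficients [ea] at [(a, a')] and [s * eb] at [(a', a)]; their
   equality makes it symmetric. *)
suff : exists (a' b' : 'I_(n + n)) (s ea eb : R),
    [/\ row b (formR_mx R n) = ea *: delta_mx 0 a',
        row b' (formR_mx R n) = eb *: delta_mx 0 a, s * eb = ea,
        [/\ a' != b', b != a' & b' != a] & @positive_move R n _ a' b' s].
  move=> [a' [b' [s [ea [eb [ra rb es [nab nab' nba] mv]]]]]].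
  have nba' : b != a.
    by apply/eqP => ba; move: ab; rewrite ba; apply/eqP; rewrite neq_ltn ltnSn.
  exists (delta_mx a b + s *: delta_mx a' b'); split.
  - rewrite mulmxDl -scalemxAl (mul_delta_row _ ra) (mul_delta_row _ rb).
    by rewrite scalerA es raddfD /= !linearZ /= !trmx_delta addrC.
  - rewrite mulmxDl !mulmxDr -!scalemxAl -!scalemxAr.
    rewrite !mul_delta_mx_0 ?scaler0 ?addr0//.
    by rewrite eq_sym.
  move=> A t A0 t0 f fI; set A1 := A + _.
  have A10 : nonneg_minors A1.
    move=> g gI; apply: le_trans (A0 g gI) _; rewrite /A1 -[t]mulr1.
    apply: det_le_positive_move => //; first by rewrite eq_sym.
    by apply: positive_move_adjacent; left.
  (* The two moves compose without a cross term because [b] differs from [a']. *)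
  have -> : A + t *: (A *m (delta_mx a b + s *: delta_mx a' b')) =
            A1 + (t * s) *: (A1 *m delta_mx a' b').
    rewrite /A1 mulmxDr mulmxDl -!scalemxAr -!scalemxAl -mulmxA mul_delta_mx_0 //.
    by rewrite mulmx0 scaler0 addr0 scalerDr addrA scalerA.
  exact: det_le_positive_move.
have [i bi] : exists i : 'I_n, b = lshift n i \/ b = rshift n i.
  by case: (fintype.splitP b) => i bi; exists i; [left|right]; apply/val_inj.
(* When [a] and [b] lie in the same half, the paired move joins the corresponding neighbours in the
   other half, in the opposite direction and with [s = 1]. *)
case: bi => bi; subst b; last first.
  have ni : (i.+1 < n)%N by have := ltn_ord a; rewrite ab /= -addnS ltn_add2l.
  have -> : a = rshift n (Ordinal ni) by apply/val_inj; rewrite /= ab /= addnS.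
  exists (lshift n i), (lshift n (Ordinal ni)), 1, (- (-1) ^+ i), ((-1) ^+ i.+1).
  rewrite !row_formR_mx; split=> //; first by rewrite mul1r exprS mulN1r.
    rewrite !eq_lshift eq_rlshift eq_lrshift; split=> //.
    by rewrite -val_eqE /= neq_ltn ltnSn.
  by apply: positive_move_adjacent; right.
have [ni|] := ltnP i.+1 n.
  have -> : a = lshift n (Ordinal ni) by apply/val_inj; rewrite /= ab.
  exists (rshift n i), (rshift n (Ordinal ni)), 1, ((-1) ^+ i), (- (-1) ^+ i.+1).
  rewrite !row_formR_mx; split=> //; first by rewrite mul1r exprS mulN1r opprK.
    rewrite !eq_rshift eq_rlshift eq_lrshift; split=> //.
    by rewrite -val_eqE /= neq_ltn ltnSn.
  by apply: positive_move_adjacent; right; rewrite /= addnS.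
(* Now [b] is column [n - 1] and [a] is column [n], so the paired move adds the last column to the
   first. The sign [(-1) ^+ n.-1] that makes it positive is also the one that the symmetry demands,
   as [i = n - 1]. *)
move=> ni; have {}ni : i.+1 = n by apply/eqP; rewrite eqn_leq ni ltn_ord.
have n0 : (0 < n)%N by rewrite -ni.
have -> : a = rshift n (Ordinal n0) by apply/val_inj; rewrite /= ab /= ni addn0.
exists (rshift n i), (lshift n (Ordinal n0)), ((-1) ^+ n.-1), ((-1) ^+ i), ((-1) ^+ 0).
rewrite !row_formR_mx; split => //;
  last by apply: positive_move_wrap; rewrite //= -addnS ni.
  by rewrite mulr1 (_ : n.-1 = i)//; have := congr1 predn ni.
by rewrite eq_rlshift !eq_lrshift.
Qed.

(** * Limits of matrix expressions *)

Section MatrixLimits.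
Context (R : realType) (T : Type) (F : set_system T) {FF : Filter F}.

(** A neighbourhood of a matrix contains a product of neighbourhoods of its finitely many
    entries. *)
Lemma cvg_mx m n (f : T -> 'M[R]_(m, n)) (M : 'M[R]_(m, n)) :
  (forall i j, f x i j @[x --> F] --> M i j) -> f x @[x --> F] --> M.
Proof.
move=> fM B [P MP PB]; rewrite /nbhs /=.
have : \forall x \near F, forall i, forall j, P i j (f x i j).
  by apply: filter_forall => i; apply: filter_forall => j; apply: fM.
by apply: filterS => x Px; apply: PB.
Qed.

Lemma cvg_mx_coord m n (f : T -> 'M[R]_(m, n)) (M : 'M[R]_(m, n)) i j :
  f x @[x --> F] --> M -> f x i j @[x --> F] --> M i j.
Proof.
move=> fM; apply: (cvg_comp f (fun N : 'M[R]_(m, n) => N i j) fM).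
exact: (@coord_continuous R m n i j M).
Qed.

Lemma cvg_mulmx m n p (f : T -> 'M[R]_(m, n)) (g : T -> 'M[R]_(n, p))
    (M : 'M[R]_(m, n)) (N : 'M[R]_(n, p)) :
  f x @[x --> F] --> M -> g x @[x --> F] --> N ->
  f x *m g x @[x --> F] --> M *m N.
Proof.
move=> fM gN; apply: cvg_mx => i j; rewrite mxE.
under eq_fun do rewrite mxE.
apply: cvg_big => [|k _]; first exact: add_continuous.
by apply: cvgM; apply: cvg_mx_coord.
Qed.

Lemma cvg_mxsub m n p q (h : 'I_p -> 'I_m) (g : 'I_q -> 'I_n)
    (f : T -> 'M[R]_(m, n)) (M : 'M[R]_(m, n)) :
  f x @[x --> F] --> M -> mxsub h g (f x) @[x --> F] --> mxsub h g M.
Proof.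
move=> fM; apply: cvg_mx => i j; rewrite mxE; under eq_fun do rewrite mxE.
exact: cvg_mx_coord.
Qed.

Lemma cvg_det n (f : T -> 'M[R]_n) (M : 'M[R]_n) :
  f x @[x --> F] --> M -> \det (f x) @[x --> F] --> \det M.
Proof.
move=> fM; apply: cvg_big => [|s _]; first exact: add_continuous.
apply: cvgM; first exact: cvg_cst.
apply: cvg_big => [|i _]; first exact: mul_continuous.
exact: cvg_mx_coord.
Qed.

(** On singular matrices [invmx] returns its argument, so it is first replaced by the adjugate
    formula, which holds eventually along [F] since the determinant is eventually nonzero. *)
Lemma cvg_invmx n (f : T -> 'M[R]_n) (M : 'M[R]_n) : \det M != 0 ->
  f x @[x --> F] --> M -> invmx (f x) @[x --> F] --> invmx M.
Proof.
move=> M0 fM.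
have fM0 : \forall x \near F, \det (f x) != 0.
  by have /cvgr_neq0 := cvg_det fM; apply.
suff : (\det (f x))^-1 *: \adj (f x) @[x --> F] --> invmx M.
  apply: cvg_trans; apply: near_eq_cvg; apply: filterS fM0 => x fx.
  by rewrite /invmx unitmxE unitfE fx.
rewrite /invmx unitmxE unitfE M0; apply: cvg_mx => i j; rewrite mxE.
under eq_fun do rewrite mxE.
apply: cvgM; first by apply: cvgV => //; apply: cvg_det.
rewrite mxE /cofactor; under eq_fun do rewrite mxE /cofactor.
apply: cvgM; first exact: cvg_cst.
by apply: cvg_det; apply: cvg_mxsub; apply: cvg_mxsub.
Qed.

End MatrixLimits.

(** * Reaching the open cell by small Lagrangian moves *)

Lemma open_small_step (R : realType) m n (U : set 'M[R]_(m, n)) A B :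
  open U -> U A -> exists2 t, 0 < t & U (A + t *: B).
Proof.
move=> oU UA.
have : A + t *: B @[t --> 0^'+] --> A.
  rewrite -[X in _ --> X]addr0 -[X in _ + X](scale0r B); apply: cvg_at_right_filter.
  apply: cvgD; first exact: cvg_cst.
  by apply: cvgZr_tmp; exact: cvg_id.
move=> /(_ U (open_nbhs_nbhs (conj oU UA))) H.
have [t [t0 Ut]] : exists t : R, 0 < t /\ U (A + t *: B).
  near (0 : R)^'+ => t; exists t; split; near: t => //.
  exact: nbhs_right_gt.
by exists t.
Unshelve. all: by end_near. Qed.

(** The matrix [1 + t X] is an isometry of [J]: the terms linear in [t] cancel because [J] is
    antisymmetric and [X J] symmetric, and the quadratic term contains [X X = 0]. *)
Lemma lagrangian_add (R : comNzRingType) m n (A : 'M[R]_(m, n)) (J X : 'M[R]_n) t :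
  J^T = - J -> (X *m J)^T = X *m J -> X *m X = 0 -> A *m J *m A^T = 0 ->
  (A + t *: (A *m X)) *m J *m (A + t *: (A *m X))^T = 0.
Proof.
move=> JT XJ XX AJA; have JX : J *m X^T = - (X *m J).
  by rewrite -XJ trmx_mul JT mulNmx opprK.
have -> : A + t *: (A *m X) = A *m (1%:M + t *: X).
  by rewrite mulmxDr mulmx1 scalemxAr.
have gJ : (1%:M + t *: X) *m J *m (1%:M + t *: X)^T = J.
  rewrite raddfD /= trmx1 linearZ /= mulmxDl mul1mx mulmxDr mulmx1 mulmxDl.
  rewrite -!scalemxAl -!scalemxAr JX -mulmxA JX mulmxN mulmxA XX mul0mx.
  by rewrite oppr0 !scaler0 addr0 scalerN -addrA subrr addr0.
rewrite trmx_mul; set g := 1%:M + _ in gJ *.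
have -> : A *m g *m J *m (g^T *m A^T) = A *m (g *m J *m g^T) *m A^T.
  by rewrite !mulmxA.
by rewrite gJ.
Qed.

(** Let [j] be least with [f j] different from [j]. Then [f j > j], so [f j - 1] is at least [j];
    earlier values are below [j] and later ones above [f j], hence [f j - 1] is free. *)
Lemma incr_descent n m (f : 'I_n -> 'I_(n + m)) :
  {homo f : i j / (i < j)%N} -> ~ (f =1 lshift m) ->
  exists j (a : 'I_(n + m)), f j = a.+1 :> nat /\ forall k, f k != a.
Proof.
move=> fI fid; have [j0 fj0] : exists j, f j != j :> nat.
  apply: contrapT => nex; apply: fid => j; apply/val_inj/eqP.
  by apply: contrapT => /negP fj; apply: nex; exists j.
have [j fj jmin] := @arg_minnP _ j0 (fun j => f j != j :> nat) (fun j => j) fj0.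
have jf : (j < f j)%N by rewrite ltn_neqAle eq_sym fj incr_leq.
have [c fjE] : exists c, f j = c.+1 :> nat
  by case: (nat_of_ord (f j)) jf => // c; exists c.
have cm : (c < n + m)%N by rewrite -fjE ltnW.
exists j, (Ordinal cm); split=> // k; apply/eqP => /(congr1 val)/= fk.
case: (ltngtP k j) => [kj|/fI|/val_inj jk].
- have : f k = k :> nat.
    by apply/eqP; apply: contraTT kj => /jmin; rewrite -leqNgt.
  by rewrite fk => ck; move: jf; rewrite fjE ck ltnS leqNgt kj.
- by rewrite fk fjE ltnNge leqnSn.
- by move: fk; rewrite jk fjE; apply/eqP; rewrite neq_ltn ltnSn orbT.
Qed.

(** Induction on the sum of the chosen column indices, which each replacement lowers by one. As [U]
    is open, every step can be taken small enough to stay inside it. *)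
Lemma lagrangian_reach (R : realType) n (U : set 'M[R]_(n, n + n)) (A : 'M[R]_(n, n + n))
    (f : 'I_n -> 'I_(n + n)) : open U -> U A -> nonneg_minors A ->
  A *m formR_mx R n *m A^T = 0 ->
  {homo f : i j / (i < j)%N} -> 0 < \det (colsub f A) ->
  exists B : 'M[R]_(n, n + n), [/\ U B, nonneg_minors B,
    B *m formR_mx R n *m B^T = 0 & 0 < \det (colsub (@lshift n n) B)].
Proof.
move=> oU; have [N] := ubnP (\sum_j f j)%N; elim: N A f => // N IH A f.
rewrite ltnS => fN UA A0 AL fI Af.
have [fE|/(incr_descent fI)[j [a [fj fa]]]] := pselect (f =1 lshift n).
  exists A; split=> //; rewrite (_ : colsub _ _ = colsub f A)//.
  by apply/matrixP => x y; rewrite !mxE fE.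
have [X [XJ XX XA]] := @lagrangian_move R n _ _ fj.
have [t t0 Ut] := open_small_step (A *m X) oU UA.
have f'I : {homo fun_replace f j a : i j / (i < j)%N}.
  by apply: fun_replace_adjacent_incr => //; right.
apply: (IH _ (fun_replace f j a) _ Ut) => //.
- apply: leq_trans fN; rewrite [X in (_ < X)%N](bigD1 j)//= (bigD1 j)//=.
  rewrite {1}/fun_replace eqxx fj.
  rewrite addSn ltnS leq_add2l; apply: leq_sum => k kj.
  by rewrite /fun_replace (negbTE kj).
- move=> g gI; apply: le_trans (XA _ _ A0 (ltW t0) g gI).
  apply: le_trans (A0 g gI) _; rewrite -[t]mulr1.
  apply: det_le_positive_move => //; last exact: ltW.
  by apply: positive_move_adjacent; left.
- by apply: lagrangian_add => //; exact: tr_formR_mx.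
(* The first move alone makes the new minor positive, and its completion to a Lagrangian move does
   not decrease it. *)
- apply: lt_le_trans (XA _ _ A0 (ltW t0) _ f'I).
  exact: positive_move_gt0.
Qed.

(** Some [n] columns are independent; sorting them only permutes the columns of the minor. *)
Lemma free_minor (R : fieldType) n m (A : 'M[R]_(n, m)) : row_free A ->
  exists2 f : 'I_n -> 'I_m, {homo f : i j / (i < j)%N} & \det (colsub f A) != 0.
Proof.
move=> fA; have fAT : row_full A^T by rewrite /row_full mxrank_tr.
pose h := fullrankfun fAT; have hI : injective h by exact: fullrankfun_inj.
have := fullrowsub_full fAT; rewrite -/h row_full_unit unitmxE unitfE => hA.
have [|c cI cP] := @incr_enum _ [set h i | i in 'I_n] n.
  by rewrite card_imset// card_ord.
exists c => //.
have hc i : exists j, h i = c j.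
  by have := cP (h i); rewrite imset_f// => /esym/codomP.
have [s hs] := fin_all_exists hc.
have sI : injective s by move=> i j e; apply: hI; rewrite !hs e.
apply: contraNneq hA => c0; rewrite -det_tr.
have -> : (rowsub h A^T)^T = col_perm (perm sI) (colsub c A).
  by apply/matrixP => i j; rewrite !mxE permE hs.
by rewrite col_permE det_mulmx c0 mul0r.
Qed.

(** * The chart inverse to [sigma] *)

Lemma row_span_unit (R : realType) n m (D : 'M[R]_n) (A : 'M[R]_(n, m)) :
  \det D != 0 -> row_span (D *m A) = row_span A.
Proof.
move=> D0; apply/vspaceP => x; rewrite !mem_row_span.
by rewrite (eqmxMfull A) // row_full_unit unitmxE unitfE.
Qed.

(** Normalises the left block to the identity, then undoes the signed row reversal of [sigma_mx].
    The value is meaningful only where the left block is invertible. *)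
Definition chart (R : realType) n (A : 'M[R]_(n, n + n)) : 'M[R]_n :=
  \matrix_(i, j) ((-1) ^+ i *
    (invmx (colsub (@lshift n n) A) *m colsub (@rshift n n) A) (rev_ord i) j).

(** A change of frame cancels in the quotient of the two blocks, so [chart] is well defined on
    subspaces in the cell. *)
Lemma chart_row_span (R : realType) n (A B : 'M[R]_(n, n + n)) :
  row_span A = row_span B -> \det (colsub (@lshift n n) A) != 0 ->
  \det (colsub (@lshift n n) B) != 0 /\ chart A = chart B.
Proof.
move=> /row_span_mulmx[D ->]; rewrite -mulmx_colsub det_mulmx mulf_eq0 negb_or.
move=> /andP[D0 B0]; split=> //; rewrite /chart -!mulmx_colsub.
set L := colsub _ _ in B0 *; set L' := colsub _ _.
have Du : D \in unitmx by rewrite unitmxE unitfE.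
have Lu : L \in unitmx by rewrite unitmxE unitfE.
have -> : D *m L' = D *m L *m (invmx L *m L') by rewrite -mulmxA mulKVmx.
by rewrite mulKmx// unitmx_mul Du.
Qed.

Lemma chart_sigma (R : realType) n (M : 'M[R]_n) : chart (sigma_mx M) = M.
Proof.
apply/matrixP => i j; rewrite mxE lsubmx_sigma invmx1 mul1mx mxE row_mxEr mxE.
by rewrite rev_ordK mulrA -expr2 sqrr_sign mul1r.
Qed.

Lemma sigma_chart (R : realType) n (A : 'M[R]_(n, n + n)) :
  \det (colsub (@lshift n n) A) != 0 ->
  sigma_mx (chart A) = invmx (colsub (@lshift n n) A) *m A.
Proof.
move=> A0; have Lu : colsub (@lshift n n) A \in unitmx by rewrite unitmxE unitfE.
have AE : A = row_mx (colsub (@lshift n n) A) (colsub (@rshift n n) A).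
  by rewrite -[LHS]hsubmxK lsubmxEsub rsubmxEsub.
rewrite [X in _ *m X]AE mul_mx_row mulVmx//; congr row_mx; apply/matrixP => i j.
by rewrite mxE mxE rev_ordK mulrA -expr2 sqrr_sign mul1r.
Qed.

Lemma cvg_chart (R : realType) n (A : 'M[R]_(n, n + n)) :
  \det (colsub (@lshift n n) A) != 0 -> chart x @[x --> A] --> chart A.
Proof.
move=> A0; apply: (cvg_mx (F := nbhs A)) => i j; rewrite mxE.
under eq_fun do rewrite mxE.
apply: cvgM; first exact: cvg_cst.
apply: cvg_mx_coord; apply: cvg_mulmx; last by apply: cvg_mxsub; exact: cvg_id.
by apply: cvg_invmx => //; apply: cvg_mxsub; exact: cvg_id.
Qed.

Lemma open_chart_preimage (R : realType) n (U : set 'M[R]_n) : open U ->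
  open [set A : 'M[R]_(n, n + n) |
    \det (colsub (@lshift n n) A) != 0 /\ U (chart A)].
Proof.
move=> oU; rewrite openE => A [A0 UA]; rewrite /interior.
have L0 : \forall B \near A, \det (colsub (@lshift n n) B) != 0.
  have : \det (colsub (@lshift n n) x) @[x --> A] --> \det (colsub (@lshift n n) A).
    by apply: (cvg_det (F := nbhs A)); apply: cvg_mxsub; exact: cvg_id.
  by move=> /cvgr_neq0; apply.
have LU : \forall B \near A, U (chart B).
  by apply: (cvg_chart A0); exact: open_nbhs_nbhs.
by apply: filterS2 L0 LU => B.
Qed.

(** * Topology of the Grassmannian, embedding and density *)

Lemma open_Gr (R : realType) k m (V : set (Gr R k m)) :
  open V = open [set A : full_rank R k m | V (subspace_of A)].
Proof. by rewrite {1}/open /= /quotient_open generic_quotient.pi.unlock. Qed.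

Lemma sigma_mx_continuous (R : realType) n : continuous (@sigma_mx R n).
Proof.
move=> M; apply: (cvg_mx (F := nbhs M)) => i j.
case: (fintype.splitP j) => k jk.
  have -> : j = lshift n k by apply/val_inj.
  rewrite row_mxEl; under eq_fun do rewrite row_mxEl.
  exact: cvg_cst.
have -> : j = rshift n k by apply/val_inj.
rewrite row_mxEr mxE; under eq_fun do rewrite row_mxEr mxE.
by apply: cvgM; [exact: cvg_cst|exact: coord_continuous].
Qed.

Lemma subspace_inj (R : realType) k m (X Y : subspaces R k m) :
  subspace_vs X = subspace_vs Y -> X = Y.
Proof. exact: val_inj. Qed.

(** Full-rank matrices carry the subspace topology, so the open set upstairs may be taken among all
    matrices, with its values prescribed only at full rank. *)
Lemma open_GrP (R : realType) k m (V : set (Gr R k m)) :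
  open V <-> exists2 W : set 'M[R]_(k, m), open W &
    forall A (fA : row_free A), V (Subspace (dim_row_span fA)) <-> W A.
Proof.
rewrite open_Gr; split=> [[W oW WV]|[W oW WV]]; exists W => //.
  move=> A fA.
  have := congr1 (fun P => P (exist _ A (mem_set fA))) WV.
  rewrite /= set_valE /= => ->.
  by rewrite (_ : subspace_of _ = Subspace (dim_row_span fA))//; exact: subspace_inj.
rewrite predeqE => -[A fA]; rewrite /= set_valE /= /subspace_of /=.
exact: iff_sym (WV _ _).
Qed.

Lemma sigma_continuous (R : realType) n : continuous (@sigma R n).
Proof.
apply/continuousP => V /open_GrP[W oW WV].
have -> : @sigma R n @^-1` V = @sigma_mx R n @^-1` W.
  by rewrite predeqE => M; exact: WV.
by move/continuousP : (@sigma_mx_continuous R n); apply.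
Qed.

Lemma LGR_ge0_sigma (R : realType) n (M : 'M[R]_n) :
  LGR_ge0 R n (sigma M) <-> tnn_sym R n M.
Proof.
by split=> -[a b]; split;
  [apply/Gr_ge0_sigma|apply/LGR_sigma|apply/LGR_sigma|apply/Gr_ge0_sigma].
Qed.

Lemma sigma_inj (R : realType) n : injective (@sigma R n).
Proof.
move=> M N /(congr1 (@subspace_vs _ _ _)) /= MN.
rewrite -[M]chart_sigma -[N]chart_sigma; apply: (chart_row_span MN _).2.
by rewrite lsubmx_sigma det1 oner_eq0.
Qed.

(** Openness onto the image: [V] collects the subspaces of the cell whose chart lies in [U], and by
    [chart_row_span] any frame can be used to test this. *)
Lemma sigma_open_image (R : realType) n (U : set 'M[R]_n) : open U ->
  exists2 V : set (Gr R n (n + n)), open V & forall M, V (sigma M) <-> U M.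
Proof.
move=> oU.
pose V := [set X : Gr R n (n + n) | exists A : 'M[R]_(n, n + n),
  [/\ row_span A = subspace_vs X, \det (colsub (@lshift n n) A) != 0 & U (chart A)]].
have VE A (fA : row_free A) : V (Subspace (dim_row_span fA)) <->
    \det (colsub (@lshift n n) A) != 0 /\ U (chart A).
  split=> [[B [/= BA B0 UB]]|[A0 UA]]; last by exists A.
  by have [A0 <-] := chart_row_span BA B0.
exists V => [|M].
  by apply/open_GrP; eexists; [exact: open_chart_preimage oU|exact: VE].
rewrite VE chart_sigma lsubmx_sigma det1.
by split=> [[]//|UM]; split=> //; rewrite oner_eq0.
Qed.

Lemma sigma_dense (R : realType) n (V : set (Gr R n (n + n))) X :
  open V -> V X -> LGR_ge0 R n X -> exists2 M, V (sigma M) & tnn_sym R n M.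
Proof.
move=> /open_GrP[W oW WV] VX [LX [A [fA AX A0]]].
have XE : X = Subspace (dim_row_span fA) by exact: subspace_inj.
have WA : W A by apply/WV; rewrite -XE.
have AL : A *m formR_mx R n *m A^T = 0 by apply/LGR_row_span; rewrite -XE.
(* Full rank gives a nonzero maximal minor, which is positive since none is negative. *)
have [f fI] := free_minor fA; rewrite neq_lt ltNge A0//= => Af.
have [B [WB B0 BL Bl]] := lagrangian_reach oW WA A0 AL fI Af.
have Bl0 := lt0r_neq0 Bl.
(* Membership in [W] does not bound the rank of [B] from below; its invertible left block does. *)
have fB : row_free B.
  rewrite -kermx_eq0; apply/eqP/(row_free_inj (_ : row_free (colsub (@lshift n n) B))).
    by rewrite row_free_unit unitmxE unitfE.
  by rewrite mul0mx mulmx_colsub mulmx_ker; apply/matrixP => i j; rewrite !mxE.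
have BE : sigma (chart B) = Subspace (dim_row_span fB).
  apply: subspace_inj; rewrite /= sigma_chart// row_span_unit//.
  by rewrite det_inv invr_eq0.
exists (chart B); first by rewrite BE WV.
apply/LGR_ge0_sigma; rewrite BE; split; first exact/LGR_row_span.
by exists B.
Qed.

Theorem proposition3p12 (R : realType) (n : nat) (hn : (0 < n)%N) :
  [/\ forall M : 'M[R]_n, LGR R n (sigma M) <-> antidiag_sym M,
      forall M : 'M[R]_n, Gr_ge0 R n (n + n) (sigma M) <-> totally_nonneg M &
      exists f : set_type (tnn_sym R n) -> set_type (LGR_ge0 R n),
        [/\ forall M, set_val (f M) = sigma (set_val M),
            embedding f &
            dense (range f)]].
Proof.
split; [exact: LGR_sigma|exact: Gr_ge0_sigma|].
have fP (M : tnn_sym R n) : LGR_ge0 R n (sigma (set_val M)).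
  by apply/LGR_ge0_sigma; exact: set_valP.
pose f (M : tnn_sym R n) : LGR_ge0 R n :=
  exist (fun X => X \in LGR_ge0 R n) _ (mem_set (fP M)).
have fE M : set_val (f M) = sigma (set_val M) by [].
exists f; split=> //.
- split=> [M N /(congr1 set_val)|M|U [U' oU' <-]].
  + by rewrite !fE => /sigma_inj/val_inj.
  + apply: continuous_comp_initial => {}M.
    apply: (@continuous_comp _ _ _ set_val (@sigma R n)); last exact: sigma_continuous.
    exact: (@initial_continuous (tnn_sym R n) _ set_val).
  (* Source and target carry subspace topologies, so the trace of [V] on the target serves for the
     trace [U] of [U']. *)
  + have [V oV VU] := sigma_open_image oU'.
    exists (set_val @^-1` V); first by exists V.
    rewrite predeqE => Y; split=> [[M UM <-]|[[M _ <-] VM]].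
      by split; [exists M|apply/VU].
    by exists M => //; apply/VU.
- move=> O [X OX] [V oV VO].
  have [|M VM MP] := sigma_dense oV _ (set_valP X); first by rewrite -VO in OX.
  pose M' : tnn_sym R n := exist (fun N => N \in tnn_sym R n) _ (mem_set MP).
  exists (f M'); split; last by exists M'.
  by rewrite -VO.
Qed.
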